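(* Let $\Gamma$ be a commutative group, let $T$ be a commutative $\Gamma$-monoid, and let $I$ and $J$ be $\Gamma$-order-ideals of $T$ with $I\subseteq J$. Then there is an isomorphism of monoids $$(T/I)/(J/I)\;\cong\;T/J.$$
   Context: Monoids are commutative, written additively, with identity $0$. A $\Gamma$-monoid is a monoid $T$ with an action $(\alpha,a)\mapsto {}^{\alpha}a$ of the group $\Gamma$ on $T$ such that ${}^{\alpha}(a+b)={}^{\alpha}a+{}^{\alpha}b$. Write $a\le b$ if $b=a+c$ for some $c\in T$. A $\Gamma$-order-ideal of $T$ is a submonoid $I$ of $T$ that is closed under the action of $\Gamma$ and hereditary ($a\le b$ and $b\in I$ imply $a\in I$). For a submonoid $H$ of a monoid $M$, $x\,\rho_H\,y$ means $(x+H)\cap(y+H)\ne\varnothing$; this is an equivalence relation, $\rho_H(x)$ is the class of $x$, and $M/H=\{\rho_H(x):x\in M\}$ is a monoid under $\rho_H(x)+\rho_H(y)=\rho_H(x+y)$. For $I\subseteq J$, $J/I=\{\rho_I(g):g\in J\}$ is regarded as a submonoid of $T/I$. *)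

(* Defs.v *)
From HB Require Import structures.
From mathcomp Require Import all_boot all_algebra.
From mathcomp Require Import boolp classical_sets.

Set Implicit Arguments.
Unset Strict Implicit.
Unset Printing Implicit Defensive.

Import GRing.Theory.

Local Open Scope ring_scope.
Local Open Scope classical_set_scope.
Local Open Scope quotient_scope.

(* Commutative monoids are [nmodType]s and submonoids (containing 0 and closed
   under +) are [addrClosed]s.  The boolean membership of the latter is no
   restriction on the subset, since excluded middle is assumed. *)

Section Quotient.
Variables (M : nmodType) (H : addrClosed M).

Definition translate (x : M) : set M := [set x + h | h in [set` H]].

Definition rho (x y : M) : bool := `[< translate x `&` translate y !=set0 >].

Lemma rhoP (x y : M) :
  reflect (exists a b, [/\ a \in H, b \in H & x + a = y + b]) (rho x y).
Proof.
apply: (iffP (asboolP _)) => [[z [[a Ha <-] [b Hb e]]]|[a [b [Ha Hb e]]]].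
  by exists a, b; split.
by exists (x + a); split; [exists a | exists b].
Qed.

Lemma rho_refl : reflexive rho.
Proof. by move=> x; apply/rhoP; exists 0, 0; rewrite !rpred0. Qed.

Lemma rho_sym : symmetric rho.
Proof.
move=> x y; apply/rhoP/rhoP => -[a [b [Ha Hb e]]]; by exists b, a; split.
Qed.

Lemma rho_trans : transitive rho.
Proof.
move=> y x z /rhoP[a [b [Ha Hb e]]] /rhoP[c [d [Hc Hd e']]]; apply/rhoP.
exists (a + c), (d + b); split; try exact: rpredD.
by rewrite addrA e addrAC e' addrA.
Qed.

Canonical rho_equiv := EquivRel rho rho_refl rho_sym rho_trans.

Definition quot := {eq_quot rho}.

HB.instance Definition _ : EqQuotient M rho quot := EqQuotient.on quot.
HB.instance Definition _ := Choice.on quot.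

Definition quot_zero : quot := \pi_quot 0.

(* By [quot_addE] below, the sum does not depend on the representatives. *)
Definition quot_add (p q : quot) : quot := \pi_quot (repr p + repr q).

Lemma pi_quotP (x y : M) : reflect (\pi_quot x = \pi_quot y) (rho x y).
Proof. exact: (@eqquotP _ _ quot). Qed.

Lemma pi_quot_surj (p : quot) : exists x, p = \pi_quot x.
Proof. by exists (repr p); rewrite reprK. Qed.

Lemma quot_addE (x y : M) :
  quot_add (\pi_quot x) (\pi_quot y) = \pi_quot (x + y).
Proof.
have rho_repr z : rho (repr (\pi_quot z)) z by apply/pi_quotP; exact: reprK.
apply/pi_quotP/rhoP.
have /rhoP[a [b [Ha Hb e]]] := rho_repr x.
have /rhoP[c [d [Hc Hd e']]] := rho_repr y.
by exists (a + c), (b + d); split; rewrite ?rpredD // addrACA e e' addrACA.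
Qed.

Lemma quot_addA : associative quot_add.
Proof.
move=> p q r.
have [[x ->] [y ->] [z ->]] := And3 (pi_quot_surj p) (pi_quot_surj q)
  (pi_quot_surj r).
by rewrite !quot_addE addrA.
Qed.

Lemma quot_addC : commutative quot_add.
Proof. by move=> p q; rewrite /quot_add addrC. Qed.

Lemma quot_add0 : left_id quot_zero quot_add.
Proof. by move=> p; have [x ->] := pi_quot_surj p; rewrite quot_addE add0r. Qed.

HB.instance Definition _ := GRing.isNmodule.Build quot
  quot_addA quot_addC quot_add0.

Lemma pi_quotD : {morph \pi_quot : x y / x + y}.
Proof. by move=> x y; rewrite -quot_addE. Qed.

End Quotient.

Section SubmonoidQuotient.
Variables (M : nmodType) (J I : addrClosed M).

(* J / I as a submonoid of M / I: the classes are those of rho_I on M. *)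
Definition subquot_pred : {pred quot I} :=
  [pred c | c \in [set \pi_(quot I) g | g in [set` J]]].

Lemma subquot_closed : GRing.nmod_closed subquot_pred.
Proof.
split=> [|p q]; rewrite !inE.
  by exists 0 => //=; exact: rpred0.
move=> [x Hx <-] [y Hy <-]; exists (x + y); rewrite ?pi_quotD //=.
exact: rpredD.
Qed.

HB.instance Definition _ :=
  GRing.isAddClosed.Build (quot I) subquot_pred subquot_closed.

Definition subquot : addrClosed (quot I) := subquot_pred.

End SubmonoidQuotient.

(* The action fixes 0 as a consequence of these axioms. *)
Definition is_gamma_action (Gamma : zmodType) (T : nmodType)
    (act : Gamma -> T -> T) : Prop :=
  [/\ forall a, act 0 a = a,
      forall alpha beta a, act (alpha + beta) a = act alpha (act beta a)
    & forall alpha a b, act alpha (a + b) = act alpha a + act alpha b].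

Definition alg_le (T : nmodType) (a b : T) : Prop := exists c, b = a + c.

Definition is_gamma_order_ideal (Gamma : zmodType) (T : nmodType)
    (act : Gamma -> T -> T) (I : addrClosed T) : Prop :=
  (forall alpha a, a \in I -> act alpha a \in I) /\
  (forall a b, alg_le a b -> b \in I -> a \in I).

Definition monoid_isomorphic (M N : nmodType) : Prop :=
  exists f : {additive M -> N}, bijective f.

(* Main.v *)
From HB Require Import structures.
Require Import Defs.
From mathcomp Require Import all_boot all_algebra.
From mathcomp Require Import boolp.

(** The class in [(T/I)/(J/I)] of the class in [T/I] of [x] determines, and is
    determined by, the class of [x] in [T/J]: the congruence on [T/I] given by
    [J/I] pulls back along [T -> T/I] to the congruence on [T] given by [J]
    ([rho_subquot]).  Indeed, an equality [x + g + i = y + h + i'] with [g, h]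
    in [J] and [i, i'] in [I] has [g + i] and [h + i'] in [J], because [I] is
    contained in [J]; the converse is the projection of an equality
    [x + g = y + h].  Hence [[x] |-> x mod J] is well defined and injective; it
    is additive and surjective because the projections are. *)

Import GRing.Theory.
Local Open Scope ring_scope.
Local Open Scope quotient_scope.

Section ThirdIsomorphism.
Variables (M : nmodType) (I J : addrClosed M).
Hypothesis sIJ : {subset I <= J}.

Lemma mem_subquot (p : quot I) :
  reflect (exists2 g, g \in J & \pi_(quot I) g = p) (p \in subquot J I).
Proof. by rewrite /subquot /= inE; apply: (iffP (asboolP _)). Qed.

Lemma rho_subquot (x y : M) :
  rho (subquot J I) (\pi_(quot I) x) (\pi_(quot I) y) = rho J x y.
Proof.
apply/rhoP/rhoP => [[_ [_ [/mem_subquot[g Jg <-] /mem_subquot[h Jh <-]]]]|].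
  rewrite -!pi_quotD => /pi_quotP/rhoP[i [i' [Ii Ii' e]]].
  have [Ji Ji'] := (sIJ _ Ii, sIJ _ Ii').
  by exists (g + i), (h + i'); split; rewrite ?rpredD // !addrA.
move=> [g [h [Jg Jh e]]]; exists (\pi_(quot I) g), (\pi_(quot I) h).
by split; [apply/mem_subquot; exists g | apply/mem_subquot; exists h |
  rewrite -!pi_quotD e].
Qed.

(** The projection of [M] onto [(M/I)/(J/I)]. *)
Definition pi_pi (x : M) : quot (subquot J I) :=
  \pi_(quot (subquot J I)) (\pi_(quot I) x).

Lemma pi_piD : {morph pi_pi : x y / x + y}.
Proof. by move=> x y; rewrite /pi_pi !pi_quotD. Qed.

Lemma pi_pi_surj (p : quot (subquot J I)) : exists x, p = pi_pi x.
Proof.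
have [q ->] := pi_quot_surj p; have [x ->] := pi_quot_surj q.
by exists x.
Qed.

Lemma pi_piP (x y : M) :
  pi_pi x = pi_pi y <-> \pi_(quot J) x = \pi_(quot J) y.
Proof.
by split=> /pi_quotP e; apply/pi_quotP; move: e; rewrite rho_subquot.
Qed.

(** The map [(M/I)/(J/I) -> M/J] sending the class of the class of [x] to the
    class of [x], computed on chosen representatives; [quot_quotE] shows that
    the choice does not matter. *)
Definition quot_quot (p : quot (subquot J I)) : quot J :=
  \pi_(quot J) (repr (repr p)).

Lemma quot_quotE (x : M) : quot_quot (pi_pi x) = \pi_(quot J) x.
Proof. by apply/pi_piP; rewrite /pi_pi !reprK. Qed.

Lemma quot_quot_morphism : nmod_morphism quot_quot.
Proof.
split=> [|p q]; first exact: (quot_quotE 0).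
have [[x ->] [y ->]] := (pi_pi_surj p, pi_pi_surj q).
by rewrite -pi_piD !quot_quotE pi_quotD.
Qed.

Lemma quot_quot_bij : bijective quot_quot.
Proof.
exists (fun q : quot J => pi_pi (repr q)) => [p|q].
  by have [x ->] := pi_pi_surj p; apply/pi_piP; rewrite reprK quot_quotE.
by rewrite quot_quotE reprK.
Qed.

Lemma quot_quot_isomorphic : monoid_isomorphic (quot (subquot J I)) (quot J).
Proof.
pose add := GRing.isNmodMorphism.Build _ _ quot_quot quot_quot_morphism.
pose f : {additive quot (subquot J I) -> quot J} := HB.pack quot_quot add.
by exists f; exact: quot_quot_bij.
Qed.

End ThirdIsomorphism.

Theorem theorem3p15 (Gamma : zmodType) (T : nmodType) (act : Gamma -> T -> T)
    (hact : is_gamma_action act) (I J : addrClosed T)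
    (hI : is_gamma_order_ideal act I) (hJ : is_gamma_order_ideal act J)
    (hIJ : {subset I <= J}) :
  monoid_isomorphic (quot (subquot J I)) (quot J).
Proof. exact: quot_quot_isomorphic. Qed.
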